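(* Consider an index-2 pHDAE system of the form $$\begin{bmatrix} E_{11} & E_{12} & 0 \\ E_{21} & E_{22} & 0 \\ 0 & 0 & 0\end{bmatrix}\begin{bmatrix}\dot x_1 \\ \dot x_2 \\ \dot x_3\end{bmatrix}=\begin{bmatrix} J_{11}-R_{11} & J_{12}-R_{12} & J_{13} \\ J_{21}-R_{21} & J_{22}-R_{22} & 0 \\ J_{31} & 0 & 0\end{bmatrix}\begin{bmatrix} x_1 \\ x_2 \\ x_3\end{bmatrix}+\begin{bmatrix} B_1-P_1 \\ B_2-P_2 \\ 0\end{bmatrix}u,$$ $$y=\begin{bmatrix} (B_1+P_1)^T & (B_2+P_2)^T & 0\end{bmatrix}\begin{bmatrix} x_1 \\ x_2 \\ x_3\end{bmatrix}+(S+N)u,$$ with total state dimension $n$ and $u(t),y(t)\in\mathbb R^m$, where $\begin{bmatrix} E_{11} & E_{12} \\ E_{21} & E_{22}\end{bmatrix}>0$ (symmetric positive definite) and $J_{22}-R_{22}$ and $J_{31}$ are nonsingular. Write $E$, $J$, $R$, $B$, $P$, $A=J-R$, $\mathcal B=B-P$, $\mathcal C=(B+P)^T$, $D=S+N$ for the coefficient matrices and $H(s)=\mathcal C(sE-A)^{-1}\mathcal B+D$ for the transfer function. Given interpolation points $\sigma_1,\dots,\sigma_r\in\mathbb C$ and tangent directions $b_1,\dots,b_r\in\mathbb C^m$, construct $$V=\begin{bmatrix} V_1^T & V_2^T & V_3^T\end{bmatrix}^T=\left[(\sigma_1E-A)^{-1}\mathcal Bb_1,\ \dots,\ (\sigma_rE-A)^{-1}\mathcal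 Bb_r\right]\in\mathbb C^{n\times r},$$ partitioned as the system, and define $\widehat V=\mathrm{diag}(I,V_2,I)$. Then the reduced system $$\widehat E\dot x_r=(\widehat J-\widehat R)x_r+\widehat{\mathcal B}u,\qquad y_r=\widehat{\mathcal C}x_r+\widehat Du,$$ with $$\widehat E=\widehat V^TE\widehat V,\quad\widehat J=\widehat V^TJ\widehat V,\quad\widehat R=\widehat V^TR\widehat V,\quad\widehat{\mathcal B}=\widehat V^T\mathcal B=\widehat V^TB-\widehat V^TP,\quad\widehat{\mathcal C}=\mathcal C\widehat V=B^T\widehat V+P^T\widehat V,\quad\widehat D=D,$$ is still port-Hamiltonian (a pHDAE system), matches the polynomial part of the transfer function $H(s)$, and satisfies the tangential interpolation conditions $$H(\sigma_i)b_i=\widehat H(\sigma_i)b_i,\qquad i=1,\dots,r,$$ where $\widehat H(s)=\widehat{\mathcal C}(s\widehat E-(\widehat J-\widehat R))^{-1}\widehat{\mathcal B}+\widehat D$ is the transfer function of the reduced system.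
   Context: A linear time-invariant system $E\dot x=(J-R)x+(B-P)u$, $x(t_0)=0$, $y=(B+P)^Tx+(S+N)u$, with $E,J,R\in\mathbb R^{n\times n}$, $B,P\in\mathbb R^{n\times m}$, $S=S^T,\ N=-N^T\in\mathbb R^{m\times m}$, is called a port-Hamiltonian differential-algebraic (pHDAE) system if: (1) $J^T=-J$ and $E=E^T$; (2) $E$ is positive semidefinite; (3) the passivity matrix $W=\begin{bmatrix} R & P \\ P^T & S\end{bmatrix}$ is symmetric positive semidefinite. A pencil $\lambda E-A$ is regular if $\det(\lambda E-A)\neq0$ for some $\lambda\in\mathbb C$; the index of a regular pencil is the size of the largest block associated with the eigenvalue $\infty$ in its Weierstrass canonical form. An index-2 pHDAE system is one whose pencil $\lambda E-(J-R)$ is regular of index 2. In the block form of the claim, $J$ and $R$ are partitioned conformably with $x=(x_1,x_2,x_3)$, so $J_{ij}=-J_{ji}^T$ and $R_{ij}=R_{ji}^T$; the blocks of $J$ in positions $(2,3),(3,2),(3,3)$, all blocks of $R$ in the third block row and column, and the third blocks of $B$ and $P$ are zero. The polynomial part of a rational matrix function is the polynomial matrix function in its decomposition as a strictly proper rational matrix function plus a polynomial matrix function. The superscript $T$ denotes the transpose.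
   Formalization: The pHDAE claim is made for real V_2, the polynomial-part claim for V_2 real or V_2^T E_22 V_2 nonsingular; all claims are also made with V_2 replaced by a real matrix of the same complex span. The inverses defining V, Ĥ(σ_i) and Ĥ(s) are assumed to exist. *)

(* Defs.v *)
(* The real numbers are an arbitrary realType R; the complex numbers are R[i]. *)
From HB Require Import structures.
From mathcomp Require Import all_boot all_order all_algebra.
From mathcomp Require Export fraction.
From mathcomp Require Export reals.
From mathcomp Require Export complex.

Set Implicit Arguments.
Unset Strict Implicit.
Unset Printing Implicit Defensive.

Import Order.TTheory GRing.Theory Num.Theory.
Local Open Scope ring_scope.

Definition possemidef (R : realType) (n : nat) (M : 'M[R]_n) : Prop :=
  M^T = M /\ forall x : 'cV[R]_n, 0 <= (x^T *m M *m x) 0 0.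

Definition posdef (R : realType) (n : nat) (M : 'M[R]_n) : Prop :=
  M^T = M /\ forall x : 'cV[R]_n, x != 0 -> 0 < (x^T *m M *m x) 0 0.

(* Coefficients of  E x' = (J - R) x + (B - P) u,
                        y = (B + P)^T x + (S + N) u. *)
Record lti (F : Type) (n m : nat) := Lti {
  ltiE : 'M[F]_n;
  ltiJ : 'M[F]_n;
  ltiR : 'M[F]_n;
  ltiB : 'M[F]_(n, m);
  ltiP : 'M[F]_(n, m);
  ltiS : 'M[F]_m;
  ltiN : 'M[F]_m }.

Definition map_lti (F G : Type) (f : F -> G) (n m : nat) (s : lti F n m) :
    lti G n m :=
  Lti (map_mx f (ltiE s)) (map_mx f (ltiJ s)) (map_mx f (ltiR s))
      (map_mx f (ltiB s)) (map_mx f (ltiP s))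
      (map_mx f (ltiS s)) (map_mx f (ltiN s)).

Definition ltiA (F : fieldType) (n m : nat) (s : lti F n m) : 'M[F]_n :=
  ltiJ s - ltiR s.
Definition lti_in (F : fieldType) (n m : nat) (s : lti F n m) : 'M[F]_(n, m) :=
  ltiB s - ltiP s.
Definition lti_out (F : fieldType) (n m : nat) (s : lti F n m) : 'M[F]_(m, n) :=
  (ltiB s + ltiP s)^T.
Definition lti_feed (F : fieldType) (n m : nat) (s : lti F n m) : 'M[F]_m :=
  ltiS s + ltiN s.

Definition passivity_mx (F : fieldType) (n m : nat) (s : lti F n m) :
    'M[F]_(n + m) :=
  block_mx (ltiR s) (ltiP s) (ltiP s)^T (ltiS s).

Definition is_pHDAE (R : realType) (n m : nat) (s : lti R n m) : Prop :=
  [/\ (ltiS s)^T = ltiS s /\ (ltiN s)^T = - ltiN s,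
      (ltiJ s)^T = - ltiJ s /\ (ltiE s)^T = ltiE s,
      possemidef (ltiE s)
    & possemidef (passivity_mx s)].

(* A system given by complex matrices is a pHDAE system when these matrices
   are real and form one. *)
Definition is_pHDAE_complex (R : realType) (n m : nat) (s : lti R[i] n m) :
    Prop :=
  exists s0 : lti R n m, s = map_lti (real_complex R) s0 /\ is_pHDAE s0.

Definition pencil_regular (F : fieldType) (n : nat) (E A : 'M[F]_n) : Prop :=
  exists l : F, \det (l *: E - A) != 0.

Definition jordan_block (F : fieldType) (a : F) (k : nat) : 'M[F]_k :=
  \matrix_(i < k, j < k)
     (if (i : nat) == j then a else if (i.+1 : nat) == j then 1 else 0).

(* X (l E - A) Y = diag(l I - Jf, l Nil - I), where Jf consists of Jordan
   blocks of sizes pf i with eigenvalues a i, and Nil of nilpotent Jordan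
   blocks of sizes q i (the blocks associated with the eigenvalue oo). *)
Definition weierstrass_form (F : fieldType) (n : nat) (E A : 'M[F]_n)
    (kf : nat) (a : 'I_kf -> F) (pf : 'I_kf -> nat)
    (kq : nat) (q : 'I_kq -> nat) : Prop :=
  [/\ forall i, (0 < pf i)%N,
      forall i, (0 < q i)%N
    & exists (e : (\sum_i pf i + \sum_i q i = n)%N) (X Y : 'M[F]_n),
      [/\ X \in unitmx, Y \in unitmx,
          X *m E *m Y = castmx (e, e)
            (block_mx 1%:M 0 0 (\mxdiag_(i < kq) jordan_block 0 (q i)))
        & X *m A *m Y = castmx (e, e)
            (block_mx (\mxdiag_(i < kf) jordan_block (a i) (pf i)) 0 0 1%:M)]].

Definition pencil_index (F : fieldType) (n : nat) (E A : 'M[F]_n) (nu : nat) :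
    Prop :=
  exists (kf : nat) (a : 'I_kf -> F) (pf : 'I_kf -> nat)
         (kq : nat) (q : 'I_kq -> nat),
    weierstrass_form E A a pf q /\ (\max_(i < kq) q i)%N = nu.

Definition transfer (F : fieldType) (n m : nat) (s : lti F n m) (z : F) :
    'M[F]_m :=
  lti_out s *m invmx (z *: ltiE s - ltiA s) *m lti_in s + lti_feed s.

(* The transfer function as a rational matrix function, in the variable 'X. *)
Definition rtransfer (F : fieldType) (n m : nat) (s : lti F n m) :
    'M[{fraction {poly F}}]_m :=
  transfer (map_lti (fun c : F => tofrac c%:P) s) (tofrac 'X).

Definition strictly_proper (F : fieldType) (f : {fraction {poly F}}) : Prop :=
  exists p q : {poly F},
    [/\ q != 0, (size p < size q)%N & f = tofrac p / tofrac q].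

Definition polynomial_part (F : fieldType) (m : nat)
    (H : 'M[{fraction {poly F}}]_m) (Q : 'M[{poly F}]_m) : Prop :=
  forall i j, strictly_proper (H i j - tofrac (Q i j)).

Definition same_polynomial_part (F : fieldType) (m : nat)
    (H1 H2 : 'M[{fraction {poly F}}]_m) : Prop :=
  exists Q : 'M[{poly F}]_m, polynomial_part H1 Q /\ polynomial_part H2 Q.

(* Projection with the plain transpose, also for complex V. *)
Definition reduce (F : fieldType) (n k m : nat) (V : 'M[F]_(n, k))
    (s : lti F n m) : lti F k m :=
  Lti (V^T *m ltiE s *m V) (V^T *m ltiJ s *m V) (V^T *m ltiR s *m V)
      (V^T *m ltiB s) (V^T *m ltiP s) (ltiS s) (ltiN s).

Definition diagIWI (F : fieldType) (n1 n2 k : nat) (W : 'M[F]_(n2, k)) :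
    'M[F]_(n1 + n2 + n1, n1 + k + n1) :=
  block_mx (block_mx 1%:M 0 0 W) 0 0 1%:M.

(* Column j is (sigma_j E - A)^-1 (B - P) b_j. *)
Definition interp_basis (F : fieldType) (n m r : nat) (s : lti F n m)
    (sigma : 'I_r -> F) (b : 'I_r -> 'cV[F]_m) : 'M[F]_(n, r) :=
  \matrix_(i < n, j < r)
     (invmx (sigma j *: ltiE s - ltiA s) *m (lti_in s *m b j)) i 0.

(* Main.v *)
(* The third block row of the system forces x1 = 0, so the transfer function is
   that of the middle block, C2 (s E22 - A22)^-1 B2 + D. As E22 is invertible,
   the first summand is strictly proper and the polynomial part is D. The
   reduction keeps the block structure and J13, J31; regularity of the reduced
   pencil makes a real W injective, so W^T E22 W is again positive definite and
   the polynomial part is still D. Interpolation holds because the state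
   x = (sigma E - A)^-1 B b lies in the range of the projection matrix: x = V z
   implies V^T (sigma E - A) V z = V^T B b, so z is the reduced state. *)
Require Import Defs.
From HB Require Import structures.
From mathcomp Require Import all_boot all_order all_algebra.

Set Implicit Arguments.
Unset Strict Implicit.
Unset Printing Implicit Defensive.

Import Order.TTheory GRing.Theory Num.Theory.
Local Open Scope ring_scope.

(** * Invertibility, and definite matrices under congruence *)

Lemma unitmx_ker0 (F : fieldType) (n : nat) (M : 'M[F]_n) :
  (forall x : 'cV[F]_n, M *m x = 0 -> x = 0) -> M \in unitmx.
Proof.
move=> injM; rewrite -unitmx_tr -row_free_unit -kermx_eq0; apply/eqP/row_matrixP=> i.
rewrite row0; apply: trmx_inj; rewrite trmx0; apply: injM.
by rewrite -[M in M *m _]trmxK -trmx_mul -row_mul mulmx_ker row0 trmx0.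
Qed.

Lemma invmx_adj (F : fieldType) (n : nat) (M : 'M[F]_n) :
  M \in unitmx -> invmx M = (\det M)^-1 *: \adj M.
Proof. by rewrite /invmx => ->. Qed.

Lemma mulmx_eq_invmx (F : fieldType) (n p : nat) (M : 'M[F]_n) (x y : 'M[F]_(n, p)) :
  M \in unitmx -> M *m x = y -> x = invmx M *m y.
Proof. by move=> uM <-; rewrite mulKmx. Qed.

Lemma posdef_unitmx (R : realType) (n : nat) (M : 'M[R]_n) :
  posdef M -> M \in unitmx.
Proof.
case=> _ posM; apply: unitmx_ker0 => x Mx0; apply/eqP/negPn/negP=> /posM.
by rewrite -mulmxA Mx0 mulmx0 mxE ltxx.
Qed.

Lemma posdef_congr (R : realType) (n k : nat) (M : 'M[R]_n) (W : 'M[R]_(n, k)) :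
  posdef M -> (forall x : 'cV[R]_k, W *m x = 0 -> x = 0) ->
  posdef (W^T *m M *m W).
Proof.
case=> symM posM injW; split=> [|x x0].
  by rewrite !trmx_mul trmxK symM mulmxA.
have /posM: W *m x != 0 by apply: contra_neq x0; apply: injW.
by rewrite trmx_mul !mulmxA.
Qed.

(** Congruence by the inclusion of the second block of coordinates. Applied to the mass matrix, it
    makes [E22] invertible. *)
Lemma posdef_drsub (R : realType) (n1 n2 : nat) (M : 'M[R]_(n1 + n2)) :
  posdef M -> posdef (drsubmx M).
Proof.
move=> posM; pose W : 'M[R]_(n1 + n2, n2) := col_mx 0 1%:M.
have -> : drsubmx M = W^T *m M *m W.
  rewrite -[in RHS](submxK M) tr_col_mx mul_row_block mul_row_col.
  by rewrite trmx0 trmx1 !mul0mx !mul1mx !add0r mulmx0 mulmx1 add0r.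
apply: posdef_congr => // x; rewrite mul_col_mx mul1mx mul0mx.
by rewrite -[0 in RHS]col_mx0 => /eq_col_mx[].
Qed.

Lemma possemidef_congr (R : realType) (n k : nat) (M : 'M[R]_n) (W : 'M[R]_(n, k)) :
  possemidef M -> possemidef (W^T *m M *m W).
Proof.
case=> symM posM; split=> [|x]; first by rewrite !trmx_mul trmxK symM mulmxA.
by have := posM (W *m x); rewrite trmx_mul !mulmxA.
Qed.

(** Projecting by a real [V] acts on the passivity matrix as the congruence by [diag(V, I)], and on
    [E] as the congruence by [V]. *)
Lemma is_pHDAE_reduce (R : realType) (n m k : nat) (s : lti R n m)
    (V : 'M[R]_(n, k)) :
  is_pHDAE s -> is_pHDAE (reduce V s).
Proof.
case=> SN [JT ET] posE posW; split=> //=.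
- by rewrite !trmx_mul trmxK JT ET mulNmx mulmxN !mulmxA.
- exact: possemidef_congr.
- have -> : passivity_mx (reduce V s) =
      (block_mx V 0 0 1%:M)^T *m passivity_mx s *m block_mx V 0 0 1%:M.
    rewrite /passivity_mx /= tr_block_mx !mulmx_block !trmx0 trmx1 trmx_mul trmxK.
    by rewrite !(mul0mx, mulmx0, mul1mx, mulmx1, addr0, add0r).
  exact: possemidef_congr.
Qed.

Lemma map_lti_reduce (F G : fieldType) (f : {rmorphism F -> G}) (n m k : nat)
    (s : lti F n m) (V : 'M[F]_(n, k)) :
  map_lti f (reduce V s) = reduce (map_mx f V) (map_lti f s).
Proof. by rewrite /map_lti /reduce /= !map_mxM map_trmx. Qed.

Lemma map_diagIWI (F G : fieldType) (f : {rmorphism F -> G}) (n1 n2 k : nat)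
    (W : 'M[F]_(n2, k)) :
  map_mx f (diagIWI n1 W) = diagIWI n1 (map_mx f W).
Proof. by rewrite /diagIWI !map_block_mx !map_mx1 !map_mx0. Qed.

Lemma mxOver_realP (R : realType) (n k : nat) (W : 'M[R[i]]_(n, k)) :
  W \is a mxOver Num.real -> exists W0, W = map_mx (real_complex R) W0.
Proof.
move=> /mxOverP realW; exists (map_mx (@complex.Re R) W).
by apply/matrixP=> i j; rewrite !mxE RRe_real.
Qed.

(** * Regularity and tangential interpolation under projection *)

Section Interpolation.

Variables (F : fieldType) (n m k : nat) (s : lti F n m) (V : 'M[F]_(n, k)).

Lemma reduce_pencil (z : F) :
  z *: ltiE (reduce V s) - ltiA (reduce V s) = V^T *m (z *: ltiE s - ltiA s) *m V.
Proof.
by rewrite /ltiA /= !(mulmxBr, mulmxBl) -scalemxAr -scalemxAl.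
Qed.

(** The reduced pencil has [V] as its right factor, so a kernel vector of [V] is killed by an
    invertible matrix. *)
Lemma pencil_regular_reduce_inj (x : 'cV[F]_k) :
  pencil_regular (ltiE (reduce V s)) (ltiA (reduce V s)) -> V *m x = 0 -> x = 0.
Proof.
case=> l; rewrite -unitfE -unitmxE reduce_pencil => u Vx0.
by rewrite -[x](mulKmx u) -!mulmxA Vx0 !mulmx0.
Qed.

Lemma reduce_interpolation (z : F) (c : 'cV[F]_m) :
  z *: ltiE s - ltiA s \in unitmx ->
  z *: ltiE (reduce V s) - ltiA (reduce V s) \in unitmx ->
  (exists x, invmx (z *: ltiE s - ltiA s) *m (lti_in s *m c) = V *m x) ->
  transfer s z *m c = transfer (reduce V s) z *m c.
Proof.
rewrite reduce_pencil /transfer reduce_pencil => u ur [x Vx].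
rewrite !mulmxDl; congr (_ + _).
have -> : lti_out (reduce V s) = lti_out s *m V.
  by rewrite /lti_out /= -mulmxDr trmx_mul trmxK.
have -> : lti_in (reduce V s) = V^T *m lti_in s by rewrite /lti_in /= -mulmxBr.
rewrite -!mulmxA Vx; congr (_ *m (_ *m _)).
apply: mulmx_eq_invmx; first by rewrite !mulmxA.
(* The full equation [(z E - A) (V x) = (B - P) c], multiplied on the left by [V^T], is the reduced
   equation for [x]. *)
by rewrite -!mulmxA -Vx mulKVmx.
Qed.

End Interpolation.

(** * Elimination in the block form *)

(** Stated over any field and with no relation between blocks, so that it also covers reduced
    systems and coefficients taken in rational functions. *)
Definition staircase (F : fieldType) (n1 n2 m : nat)
    (E11 : 'M[F]_n1) (E12 : 'M[F]_(n1, n2)) (E21 : 'M[F]_(n2, n1)) (E22 : 'M[F]_n2)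
    (J11 : 'M[F]_n1) (J12 : 'M[F]_(n1, n2)) (J13 : 'M[F]_n1)
    (J21 : 'M[F]_(n2, n1)) (J22 : 'M[F]_n2) (J31 : 'M[F]_n1)
    (R11 : 'M[F]_n1) (R12 : 'M[F]_(n1, n2)) (R21 : 'M[F]_(n2, n1)) (R22 : 'M[F]_n2)
    (B1 P1 : 'M[F]_(n1, m)) (B2 P2 : 'M[F]_(n2, m)) (S N : 'M[F]_m) :
    lti F (n1 + n2 + n1) m :=
  Lti (block_mx (block_mx E11 E12 E21 E22) 0 0 0)
      (block_mx (block_mx J11 J12 J21 J22) (col_mx J13 0) (row_mx J31 0) 0)
      (block_mx (block_mx R11 R12 R21 R22) 0 0 0)
      (col_mx (col_mx B1 B2) 0) (col_mx (col_mx P1 P2) 0) S N.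

Section Staircase.

Variables (F : fieldType) (n1 n2 m : nat).
Variables (E11 : 'M[F]_n1) (E12 : 'M[F]_(n1, n2)) (E21 : 'M[F]_(n2, n1)) (E22 : 'M[F]_n2).
Variables (J11 : 'M[F]_n1) (J12 : 'M[F]_(n1, n2)) (J13 : 'M[F]_n1).
Variables (J21 : 'M[F]_(n2, n1)) (J22 : 'M[F]_n2) (J31 : 'M[F]_n1).
Variables (R11 : 'M[F]_n1) (R12 : 'M[F]_(n1, n2)) (R21 : 'M[F]_(n2, n1)) (R22 : 'M[F]_n2).
Variables (B1 P1 : 'M[F]_(n1, m)) (B2 P2 : 'M[F]_(n2, m)) (S N : 'M[F]_m).

Let s := staircase E11 E12 E21 E22 J11 J12 J13 J21 J22 J31 R11 R12 R21 R22
  B1 P1 B2 P2 S N.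

Lemma map_staircase (G : fieldType) (f : {rmorphism F -> G}) :
  map_lti f s = staircase
    (map_mx f E11) (map_mx f E12) (map_mx f E21) (map_mx f E22)
    (map_mx f J11) (map_mx f J12) (map_mx f J13)
    (map_mx f J21) (map_mx f J22) (map_mx f J31)
    (map_mx f R11) (map_mx f R12) (map_mx f R21) (map_mx f R22)
    (map_mx f B1) (map_mx f P1) (map_mx f B2) (map_mx f P2)
    (map_mx f S) (map_mx f N).
Proof.
by rewrite /map_lti /= !map_block_mx !map_col_mx map_row_mx !map_mx0.
Qed.

(** [diag(I, W, I)] changes only the second block row and column. Results on the block form
    therefore apply to the reduced system with the same [J13] and [J31]. *)
Lemma reduce_staircase (k : nat) (W : 'M[F]_(n2, k)) :
  reduce (diagIWI n1 W) s = staircase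
    E11 (E12 *m W) (W^T *m E21) (W^T *m E22 *m W)
    J11 (J12 *m W) J13 (W^T *m J21) (W^T *m J22 *m W) J31
    R11 (R12 *m W) (W^T *m R21) (W^T *m R22 *m W)
    B1 P1 (W^T *m B2) (W^T *m P2) S N.
Proof.
rewrite /reduce /diagIWI /=.
rewrite !tr_block_mx !trmx0 !trmx1 !mulmx_block.
rewrite !(mul0mx, mulmx0, mul1mx, mulmx1, addr0, add0r).
rewrite !mulmx_block !mul_block_col !mul_row_block.
by rewrite !(mul0mx, mulmx0, mul1mx, mulmx1, addr0, add0r).
Qed.

(* The constraint [J31 x1 = 0] forces [x1 = 0], so only the second block of
   the state contributes to the output. *)
Lemma transfer_staircase (z : F) :
  J13 \in unitmx -> J31 \in unitmx -> z *: E22 - (J22 - R22) \in unitmx ->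
  transfer s z =
    (B2 + P2)^T *m invmx (z *: E22 - (J22 - R22)) *m (B2 - P2) + (S + N).
Proof.
move=> u13 u31 u22; rewrite /transfer; congr (_ + _).
set M22 := _ - _ in u22 *.
set M11 := z *: E11 - (J11 - R11); set M12 := z *: E12 - (J12 - R12).
set M21 := z *: E21 - (J21 - R21).
have -> : z *: ltiE s - ltiA s = block_mx (block_mx M11 M12 M21 M22)
    (col_mx (- J13) 0) (row_mx (- J31) 0) 0.
  rewrite /ltiA /= !scale_block_mx !opp_block_mx !add_block_mx !opp_block_mx.
  rewrite !add_block_mx !(scaler0, oppr0, addr0, add0r).
  by rewrite opp_col_mx opp_row_mx !oppr0.
set M := block_mx _ _ _ _.
have mulM p (x1 : 'M[F]_(n1, p)) (x2 : 'M[F]_(n2, p)) (x3 : 'M[F]_(n1, p)) :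
    M *m col_mx (col_mx x1 x2) x3 = col_mx (col_mx
      (M11 *m x1 + M12 *m x2 - J13 *m x3) (M21 *m x1 + M22 *m x2)) (- (J31 *m x1)).
  rewrite /M !mul_block_col mul_col_mx mul_row_col add_col_mx.
  by rewrite !(mul0mx, addr0) !mulNmx.
(* On a kernel vector, the third row gives [x1 = 0] through [J31], then the second gives [x2 = 0]
   through [M22], and the first gives [x3 = 0] through [J13]. *)
have uM : M \in unitmx.
  apply: unitmx_ker0 => x; rewrite -[x]vsubmxK -[usubmx x]vsubmxK mulM.
  rewrite -[0 in X in X -> _]col_mx0 => /eq_col_mx[].
  rewrite -[0 in X in X -> _]col_mx0 => /eq_col_mx[e1 e2] /eqP.
  rewrite oppr_eq0 => /eqP e3.
  have x1 : usubmx (usubmx x) = 0 by rewrite (mulmx_eq_invmx u31 e3) mulmx0.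
  move: e1 e2; rewrite x1 !mulmx0 !add0r => + e2.
  have x2 : dsubmx (usubmx x) = 0 by rewrite (mulmx_eq_invmx u22 e2) mulmx0.
  rewrite x2 mulmx0 sub0r => /eqP; rewrite oppr_eq0 => /eqP e1.
  by rewrite (mulmx_eq_invmx u13 e1) mulmx0 !col_mx0.
(* The explicit solution for the input matrix: [x1 = 0], [x2] solves the second row, and [x3] is
   chosen to balance the first. *)
rewrite -!mulmxA -(@mulmx_eq_invmx _ _ _ _ (col_mx (col_mx 0 (invmx M22 *m (B2 - P2)))
  (invmx J13 *m (M12 *m (invmx M22 *m (B2 - P2)) - (B1 - P1)))) _ uM).
  rewrite /lti_out /= !add_col_mx !tr_col_mx !mul_row_col addr0 trmx0 mul0mx.
  by rewrite mulmx0 add0r addr0.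
rewrite mulM !mulmx0 !add0r !mulKVmx // opprB addrC subrK oppr0.
by rewrite /lti_in /= !opp_col_mx !add_col_mx oppr0 addr0.
Qed.

End Staircase.

(** * Strict properness of the resolvent of a pencil with invertible leading matrix *)

Section StrictlyProper.

Variable F : fieldType.

Lemma size_mulmx_polyCl (p n q d : nat) (C : 'M[F]_(p, n)) (G : 'M[{poly F}]_(n, q)) :
  (forall i j, (size (G i j) <= d)%N) ->
  forall i j, (size ((map_mx polyC C *m G) i j) <= d)%N.
Proof.
move=> leG i j; rewrite mxE.
apply: (big_ind (fun f : {poly F} => (size f <= d)%N)) => [|f g lef leg|k _].
- by rewrite size_poly0.
- by apply: leq_trans (size_polyD f g) _; rewrite geq_max lef.
- rewrite mxE; have [->|c0] := eqVneq (C i k) 0; first by rewrite mul0r size_poly0.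
  by rewrite size_Cmul.
Qed.

Lemma size_mulmx_polyCr (p n q d : nat) (G : 'M[{poly F}]_(p, n)) (C : 'M[F]_(n, q)) :
  (forall i j, (size (G i j) <= d)%N) ->
  forall i j, (size ((G *m map_mx polyC C) i j) <= d)%N.
Proof.
move=> leG i j; rewrite -[_ *m _]trmxK mxE trmx_mul map_trmx.
by apply: size_mulmx_polyCl => k l; rewrite mxE.
Qed.

(** Since [char_poly M] has size [n.+1], this bound makes every entry of the resolvent strictly
    proper. Comparing degrees at an entry of largest size avoids expanding cofactors. *)
Lemma size_adj_char_poly_mx (n : nat) (M : 'M[F]_n) i j :
  (size ((\adj (char_poly_mx M)) i j) <= n)%N.
Proof.
set G := \adj _.
have [i0 [j0 maxG]] : exists i0 j0, forall i j, (size (G i j) <= size (G i0 j0))%N.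
  have [/= p _ maxG] := @arg_maxnP _ (i, j) xpredT (fun p => size (G p.1 p.2)) isT.
  by exists p.1, p.2 => i' j'; apply: (maxG (i', j')).
apply: leq_trans (maxG i j) _; have [->|G0] := eqVneq (G i0 j0) 0.
  by rewrite size_poly0.
(* In [X G = chi I + M G], the largest entry of [G] gains a degree on the left,
   which only [chi] can compensate. *)
have /matrixP/(_ i0 j0) := mul_mx_adj (char_poly_mx M).
rewrite -/G -/(char_poly M) mulmxBl mul_scalar_mx mxE [X in X + _]mxE [X in _ + X]mxE.
move=> /eqP; rewrite subr_eq mulrC => /eqP eG.
have := size_mulX G0; rewrite eG => sz.
have := size_polyD ((char_poly M)%:M i0 j0) ((map_mx polyC M *m G) i0 j0).
rewrite sz leq_max => /orP[|]; last first.
  by rewrite ltnNge size_mulmx_polyCl.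
move=> /leq_trans; move/(_ n.+1); rewrite ltnS; apply.
by rewrite mxE; case: eqP; rewrite ?mulr1n ?mulr0n ?size_poly0 // size_char_poly.
Qed.

(** The embedding of constants used by [rtransfer], packaged as a ring morphism so that it commutes
    with matrix operations. *)
Let phi : {rmorphism F -> {fraction {poly F}}} := @tofrac {poly F} \o @polyC F.

(** Pulling out [E] leaves an ordinary characteristic matrix, whose determinant is monic. *)
Lemma pencil_frac_factor (n : nat) (E A : 'M[F]_n) :
  E \in unitmx ->
  tofrac 'X *: map_mx phi E - map_mx phi A =
    map_mx phi E *m map_mx (@tofrac {poly F}) (char_poly_mx (invmx E *m A)).
Proof.
move=> uE; rewrite map_mxB map_scalar_mx mulmxBr mul_mx_scalar -map_mx_comp.
by rewrite -map_mxM mulKVmx.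
Qed.

Lemma unitmx_frac_char_poly_mx (n : nat) (M : 'M[F]_n) :
  map_mx (@tofrac {poly F}) (char_poly_mx M) \in unitmx.
Proof.
by rewrite unitmxE det_map_mx unitfE tofrac_eq0 monic_neq0 ?char_poly_monic.
Qed.

Lemma unitmx_pencil_frac (n : nat) (E A : 'M[F]_n) :
  E \in unitmx -> tofrac 'X *: map_mx phi E - map_mx phi A \in unitmx.
Proof.
move=> uE; rewrite pencil_frac_factor // unitmx_mul map_unitmx uE.
exact: unitmx_frac_char_poly_mx.
Qed.

(** By Cramer's rule the denominator is the characteristic polynomial of [invmx E *m A] and the
    numerator comes from the adjugate. Constant factors on either side do not raise degrees. *)
Lemma strictly_proper_resolvent (n p q : nat) (E A : 'M[F]_n)
    (C : 'M[F]_(p, n)) (B : 'M[F]_(n, q)) i j :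
  E \in unitmx ->
  strictly_proper ((map_mx phi C *m invmx (tofrac 'X *: map_mx phi E - map_mx phi A)
    *m map_mx phi B) i j).
Proof.
move=> uE; set M := invmx E *m A.
pose T := map_mx (@tofrac {poly F}) (char_poly_mx M).
have uT : T \in unitmx := unitmx_frac_char_poly_mx M.
have dT : \det T = tofrac (char_poly M) by rewrite det_map_mx.
have phiE k l (X : 'M[F]_(k, l)) :
    map_mx phi X = map_mx (@tofrac {poly F}) (map_mx polyC X).
  by rewrite -map_mx_comp.
(* The factor [invmx E] is absorbed into the constant matrix [B]. *)
have eB : invmx (tofrac 'X *: map_mx phi E - map_mx phi A) *m map_mx phi B =
    invmx T *m map_mx phi (invmx E *m B).
  apply/esym/mulmx_eq_invmx; first exact: unitmx_pencil_frac.
  by rewrite pencil_frac_factor // -mulmxA mulKVmx // -map_mxM mulKVmx.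
have -> : map_mx phi C *m invmx (tofrac 'X *: map_mx phi E - map_mx phi A)
    *m map_mx phi B = (\det T)^-1 *:
    map_mx (@tofrac {poly F})
      (map_mx polyC C *m \adj (char_poly_mx M) *m map_mx polyC (invmx E *m B)).
  rewrite -mulmxA eB (invmx_adj uT) -scalemxAl -scalemxAr mulmxA; congr (_ *: _).
  by rewrite !(map_mxM (@tofrac {poly F})) map_mx_adj -phiE -phiE.
exists ((map_mx polyC C *m \adj (char_poly_mx M) *m map_mx polyC (invmx E *m B)) i j),
  (char_poly M); split.
- by rewrite monic_neq0 ?char_poly_monic.
- rewrite size_char_poly ltnS; apply: size_mulmx_polyCr => {}i {}j.
  by apply: size_mulmx_polyCl => {}i {}j; apply: size_adj_char_poly_mx.
- by rewrite dT mxE [X in _ * X]mxE mulrC.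
Qed.

Lemma polynomial_part_staircase (n1 n2 m : nat)
    (E11 : 'M[F]_n1) (E12 : 'M[F]_(n1, n2)) (E21 : 'M[F]_(n2, n1)) (E22 : 'M[F]_n2)
    (J11 : 'M[F]_n1) (J12 : 'M[F]_(n1, n2)) (J13 : 'M[F]_n1)
    (J21 : 'M[F]_(n2, n1)) (J22 : 'M[F]_n2) (J31 : 'M[F]_n1)
    (R11 : 'M[F]_n1) (R12 : 'M[F]_(n1, n2)) (R21 : 'M[F]_(n2, n1)) (R22 : 'M[F]_n2)
    (B1 P1 : 'M[F]_(n1, m)) (B2 P2 : 'M[F]_(n2, m)) (S N : 'M[F]_m) :
  J13 \in unitmx -> J31 \in unitmx -> E22 \in unitmx ->
  polynomial_part
    (rtransfer (staircase E11 E12 E21 E22 J11 J12 J13 J21 J22 J31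
       R11 R12 R21 R22 B1 P1 B2 P2 S N))
    (map_mx polyC (S + N)).
Proof.
move=> u13 u31 u22 i j; rewrite /rtransfer.
rewrite -[map_lti _ _]/(map_lti phi _) map_staircase.
rewrite transfer_staircase ?map_unitmx // -?map_mxB; last exact: unitmx_pencil_frac.
rewrite -!map_mxD mxE [map_mx phi (S + N) i j]mxE [map_mx polyC (S + N) i j]mxE addrK.
by rewrite map_trmx; apply: strictly_proper_resolvent.
Qed.

End StrictlyProper.

(** * The reduction by [diag(I, W, I)] *)

Lemma diagIWI_mul (F : fieldType) (n1 n2 k : nat) (W : 'M[F]_(n2, k))
    (x1 x3 : 'cV[F]_n1) (x2 : 'cV[F]_k) :
  diagIWI n1 W *m col_mx (col_mx x1 x2) x3 = col_mx (col_mx x1 (W *m x2)) x3.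
Proof.
by rewrite /diagIWI !mul_block_col !mul1mx !mul0mx !addr0 !add0r.
Qed.

Theorem theorem5 (R : realType) (n1 n2 m r : nat)
    (E11 : 'M[R]_n1) (E12 : 'M[R]_(n1, n2))
    (E21 : 'M[R]_(n2, n1)) (E22 : 'M[R]_n2)
    (J11 : 'M[R]_n1) (J12 : 'M[R]_(n1, n2)) (J13 : 'M[R]_n1)
    (J21 : 'M[R]_(n2, n1)) (J22 : 'M[R]_n2) (J31 : 'M[R]_n1)
    (R11 : 'M[R]_n1) (R12 : 'M[R]_(n1, n2))
    (R21 : 'M[R]_(n2, n1)) (R22 : 'M[R]_n2)
    (B1 P1 : 'M[R]_(n1, m)) (B2 P2 : 'M[R]_(n2, m)) (S N : 'M[R]_m)
    (sigma : 'I_r -> R[i]) (b : 'I_r -> 'cV[R[i]]_m) :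
  let sys : lti R (n1 + n2 + n1) m :=
    Lti (block_mx (block_mx E11 E12 E21 E22) 0 0 0)
        (block_mx (block_mx J11 J12 J21 J22) (col_mx J13 0) (row_mx J31 0) 0)
        (block_mx (block_mx R11 R12 R21 R22) 0 0 0)
        (col_mx (col_mx B1 B2) 0) (col_mx (col_mx P1 P2) 0) S N in
  let sysC : lti R[i] (n1 + n2 + n1) m := map_lti (real_complex R) sys in
  is_pHDAE sys ->
  pencil_regular (ltiE sysC) (ltiA sysC) ->
  pencil_index (ltiE sysC) (ltiA sysC) 2 ->
  posdef (block_mx E11 E12 E21 E22) ->
  J22 - R22 \in unitmx ->
  J31 \in unitmx ->
  (forall i, sigma i *: ltiE sysC - ltiA sysC \in unitmx) ->
  let V : 'M[R[i]]_(n1 + n2 + n1, r) := interp_basis sysC sigma b in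
  let V2 : 'M[R[i]]_(n2, r) := dsubmx (usubmx V) in
  let conclusion (k : nat) (W : 'M[R[i]]_(n2, k)) : Prop :=
    let red : lti R[i] (n1 + k + n1) m := reduce (diagIWI n1 W) sysC in
    let W_real := W \is a mxOver Num.real in
    [/\ W_real -> is_pHDAE_complex red,
        pencil_regular (ltiE red) (ltiA red) ->
        W_real \/ W^T *m map_mx (real_complex R) E22 *m W \in unitmx ->
        same_polynomial_part (rtransfer sysC) (rtransfer red)
      & forall i, sigma i *: ltiE red - ltiA red \in unitmx ->
        transfer sysC (sigma i) *m b i = transfer red (sigma i) *m b i] in
  conclusion r V2 /\
  (forall (k : nat) (W : 'M[R]_(n2, k)),
     ((map_mx (real_complex R) W)^T == V2^T)%MS ->
     conclusion k (map_mx (real_complex R) W)).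
Proof.
move=> sys sysC pH _ _ posE _ u31 uS V V2 conclusion.
pose phi := real_complex R.
have [_ [JT _] _ _] := pH.
(* Skew-symmetry of [J] gives [J13 = - J31^T]. *)
have u13 : J13 \in unitmx.
  move: JT; rewrite /= tr_block_mx opp_block_mx => /eq_block_mx[_ + _ _].
  rewrite tr_row_mx opp_col_mx => /eq_col_mx[/eqP + _].
  by rewrite -eqr_oppLR => /eqP<-; rewrite -scaleN1r unitmxZ ?unitrN1 // unitmx_tr.
have posE22 : posdef E22 by have := posdef_drsub posE; rewrite block_mxKdr.
have sysCE : sysC = staircase
    (map_mx phi E11) (map_mx phi E12) (map_mx phi E21) (map_mx phi E22)
    (map_mx phi J11) (map_mx phi J12) (map_mx phi J13)
    (map_mx phi J21) (map_mx phi J22) (map_mx phi J31)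
    (map_mx phi R11) (map_mx phi R12) (map_mx phi R21) (map_mx phi R22)
    (map_mx phi B1) (map_mx phi P1) (map_mx phi B2) (map_mx phi P2)
    (map_mx phi S) (map_mx phi N).
  exact: map_staircase.
(* The inclusion compares column spaces, through row spaces of transposes. It holds both for [V2]
   itself and for a real matrix with the same column space. *)
have main k (W : 'M[R[i]]_(n2, k)) : (V2^T <= W^T)%MS -> conclusion k W.
  move=> subW; split.
  - case/mxOver_realP=> W0 WE; exists (reduce (diagIWI n1 W0) sys); split.
      by rewrite map_lti_reduce map_diagIWI WE.
    exact: is_pHDAE_reduce.
  - move=> reg unitW.
    have u22 : W^T *m map_mx phi E22 *m W \in unitmx.
      case: unitW => // /mxOver_realP[W0 WE].
      rewrite WE map_trmx -!map_mxM map_unitmx.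
      apply/posdef_unitmx/posdef_congr => // x W0x.
      (* Then [diag(I, W, I)] kills [(0, x, 0)], so regularity of the reduced pencil forces
         [x = 0]. *)
      have Wx : W *m map_mx phi x = 0 by rewrite WE -map_mxM W0x map_mx0.
      have := @pencil_regular_reduce_inj _ _ _ _ _ _
        (col_mx (col_mx 0 (map_mx phi x)) 0) reg.
      rewrite diagIWI_mul Wx !col_mx0 => /(_ erefl) /eqP.
      by rewrite !col_mx_eq0 map_mx_eq0 => /andP[/andP[_ /eqP]].
    exists (map_mx polyC (map_mx phi S + map_mx phi N)).
    rewrite sysCE reduce_staircase.
    split; apply: polynomial_part_staircase; rewrite ?map_unitmx //.
    exact: posdef_unitmx.
  - move=> j ured; apply: reduce_interpolation => //.
    set x := invmx _ *m _.
    have xE : col j V = x by apply/matrixP=> a c; rewrite [LHS]mxE [LHS]mxE ord1.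
    have /submxP[D V2E] := subW.
    (* The outer blocks of the state are copied. Since [V2 = W *m D^T], the middle block has
       coordinates [col j D^T] with respect to [W]. *)
    exists (col_mx (col_mx (usubmx (usubmx x)) (col j D^T)) (dsubmx x)).
    rewrite diagIWI_mul -[LHS]vsubmxK -[usubmx x in LHS]vsubmxK.
    congr (col_mx (col_mx _ _) _).
    rewrite colE mulmxA -[W]trmxK -trmx_mul -V2E trmxK -colE -xE.
    by apply/matrixP=> a c; rewrite !mxE.
split=> [|k W /andP[_ subW]]; exact: main.
Qed.
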